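(* Let $A$ be a finitely generated free group, let $C$ be a finitely generated free group, and let $G=A*_C$ be an HNN-extension of $A$ over $C$; that is, $G=\langle A,t\mid t^{-1}\iota_1(c)t=\iota_2(c),\ \forall c\in C\rangle$ for two monomorphisms $\iota_1,\iota_2\colon C\to A$. Then $G$ admits a finite complete rewriting system.
   Context: A rewriting system is a pair $(X,\mathcal{R})$ with $X$ a finite set and $\mathcal{R}\subseteq X^*\times X^*$, where $X^*$ is the free monoid on $X$. Write $x\to_{\mathcal{R}}y$ if $x=x_1ux_2$, $y=x_1vx_2$ for some $(u,v)\in\mathcal{R}$, and let $\to^*_{\mathcal{R}}$ be the reflexive transitive closure. The system is finite if $X$ and $\mathcal{R}$ are finite; terminating if there is no infinite chain $x_0\to_{\mathcal{R}}x_1\to_{\mathcal{R}}\cdots$; confluent if whenever $x\to^*_{\mathcal{R}}y$ and $x\to^*_{\mathcal{R}}z$ there is $\bar x$ with $y\to^*_{\mathcal{R}}\bar x$ and $z\to^*_{\mathcal{R}}\bar x$; complete if terminating and confluent. A group $G$ admits a finite complete rewriting system if there is a finite complete rewriting system $(X,\mathcal{R})$ such that the monoid with presentation $\langle X\mid\mathcal{R}\rangle$ is isomorphic to $G$. *)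

(* Defs.v *)
From Stdlib Require Import Relation_Operators.
From HB Require Import structures.
From mathcomp Require Import all_boot.
From mathcomp Require Import boolp classical_sets cardinality.

Set Implicit Arguments.
Unset Strict Implicit.
Unset Printing Implicit Defensive.

Local Open Scope group_scope.
Local Open Scope quotient_scope.
Local Open Scope classical_set_scope.

(* The free monoid on X is represented by [seq X] with concatenation. *)

Section Rewriting.
Variables (X : Type) (R : set (seq X * seq X)).

Definition rewrite_step (x y : seq X) : Prop :=
  exists x1 u v x2 : seq X,
    [/\ R (u, v), x = x1 ++ u ++ x2 & y = x1 ++ v ++ x2].

Definition rewrites : seq X -> seq X -> Prop :=
  clos_refl_trans (seq X) rewrite_step.

Definition terminating : Prop :=
  ~ exists f : nat -> seq X, forall n, rewrite_step (f n) (f n.+1).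

Definition confluent : Prop :=
  forall x y z, rewrites x y -> rewrites x z ->
    exists w, rewrites y w /\ rewrites z w.

Definition complete_system : Prop := terminating /\ confluent.

(* The equivalence closure of one-step rewriting is the least congruence of
   the free monoid that contains R. *)
Definition pres_congr : seq X -> seq X -> Prop :=
  clos_refl_sym_trans (seq X) rewrite_step.

Lemma pres_congr_cat (a b x y : seq X) :
  pres_congr x y -> pres_congr (a ++ x ++ b) (a ++ y ++ b).
Proof.
elim=> {x y} [x y [x1 [u [v [x2 [Ruv -> ->]]]]]|x|x y _ IH|x y z _ IH1 _ IH2].
- by apply: rst_step; exists (a ++ x1), u, v, (x2 ++ b); rewrite -!catA.
- exact: rst_refl.
- exact: rst_sym.
- exact: rst_trans IH1 IH2.
Qed.

Lemma pres_congr_cat2 (x x' y y' : seq X) :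
  pres_congr x x' -> pres_congr y y' -> pres_congr (x ++ y) (x' ++ y').
Proof.
move=> Hx Hy; apply: (rst_trans _ _ _ (x' ++ y)).
  exact: (@pres_congr_cat [::] y).
by have := @pres_congr_cat x' [::] _ _ Hy; rewrite !cats0.
Qed.

End Rewriting.

Section MonoidPresentation.
Variables (X : choiceType) (R : set (seq X * seq X)).

Definition pres_equiv_rel : rel (seq X) := fun x y => `[< pres_congr R x y >].

Lemma pres_equiv_refl : reflexive pres_equiv_rel.
Proof. by move=> x; apply/asboolP; exact: rst_refl. Qed.

Lemma pres_equiv_sym : symmetric pres_equiv_rel.
Proof. by move=> x y; apply/asboolP/asboolP; exact: rst_sym. Qed.

Lemma pres_equiv_trans : transitive pres_equiv_rel.
Proof.
by move=> y x z /asboolP xy /asboolP yz; apply/asboolP; exact: rst_trans xy yz.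
Qed.

Canonical pres_equiv :=
  EquivRel pres_equiv_rel pres_equiv_refl pres_equiv_sym pres_equiv_trans.

Definition pres_monoid : Type := {eq_quot pres_equiv}.

HB.instance Definition _ := Choice.on pres_monoid.

Definition pres_class (w : seq X) : pres_monoid := \pi_{eq_quot pres_equiv} w.

Definition pres_repr (p : pres_monoid) : seq X :=
  repr (p : {eq_quot pres_equiv}).

Lemma pres_reprK p : pres_class (pres_repr p) = p.
Proof. exact: reprK. Qed.

Lemma pres_classP (x y : seq X) : pres_class x = pres_class y <-> pres_congr R x y.
Proof. by split=> [/eqmodP/asboolP|H] //; apply/eqmodP/asboolP. Qed.

Lemma pres_repr_class (x : seq X) : pres_congr R (pres_repr (pres_class x)) x.
Proof. by apply/pres_classP; rewrite pres_reprK. Qed.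

Definition pres_mul (p q : pres_monoid) : pres_monoid :=
  pres_class (pres_repr p ++ pres_repr q).

Lemma pres_mulE (x y : seq X) :
  pres_mul (pres_class x) (pres_class y) = pres_class (x ++ y).
Proof.
by apply/pres_classP; apply: pres_congr_cat2; exact: pres_repr_class.
Qed.

Lemma pres_mulA : associative pres_mul.
Proof.
move=> p q r; rewrite -(pres_reprK p) -(pres_reprK q) -(pres_reprK r).
by rewrite !pres_mulE catA.
Qed.

Lemma pres_mul1 : left_id (pres_class [::]) pres_mul.
Proof. by move=> p; rewrite -(pres_reprK p) pres_mulE. Qed.

Lemma pres_mulr1 : right_id (pres_class [::]) pres_mul.
Proof. by move=> p; rewrite -(pres_reprK p) pres_mulE cats0. Qed.

HB.instance Definition _ :=
  isMonoid.Build pres_monoid pres_mulA pres_mul1 pres_mulr1.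

End MonoidPresentation.

Section GroupPresentation.
Variable S : choiceType.

(* A group word is a word over S * bool: (s, true) stands for s and (s, false)
   for the formal inverse of s. *)
Definition flip_letter (l : S * bool) : S * bool := (l.1, ~~ l.2).

Definition inv_word (w : seq (S * bool)) : seq (S * bool) :=
  rev (map flip_letter w).

Lemma inv_wordK : involutive inv_word.
Proof.
move=> w; rewrite /inv_word map_rev revK -map_comp -[RHS]map_id.
by apply: eq_map => -[s b]; rewrite /flip_letter /= negbK.
Qed.

Definition free_cancel : set (seq (S * bool) * seq (S * bool)) :=
  [set r | exists l, r = ([:: l; flip_letter l], [::])].

Variable R : set (seq (S * bool) * seq (S * bool)).

(* The group < S | u = v for (u, v) in R >. *)
Definition pres_group : Type := pres_monoid (R `|` free_cancel).

HB.instance Definition _ := Monoid.on pres_group.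

Let cong := pres_congr (R `|` free_cancel).

Lemma congr_wordV (w : seq (S * bool)) : cong (w ++ inv_word w) [::].
Proof.
elim: w => [|l w IH]; first exact: rst_refl.
rewrite /inv_word /= rev_cons -cats1 -/(inv_word w).
apply: (rst_trans _ _ _ [:: l; flip_letter l]).
  have := @pres_congr_cat _ _ [:: l] [:: flip_letter l] _ _ IH.
  by rewrite /= -catA.
apply: rst_step; exists [::], [:: l; flip_letter l], [::], [::]; split=> //.
by right; exists l.
Qed.

Lemma congr_Vword (w : seq (S * bool)) : cong (inv_word w ++ w) [::].
Proof. by have := congr_wordV (inv_word w); rewrite inv_wordK. Qed.

Lemma congr_inv_word (u v : seq (S * bool)) :
  cong u v -> cong (inv_word u) (inv_word v).
Proof.
move=> uv; apply: (rst_trans _ _ _ (inv_word u ++ v ++ inv_word v)).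
  apply: rst_sym; have := @pres_congr_cat _ _ (inv_word u) [::] _ _ (congr_wordV v).
  by rewrite !cats0.
apply: (rst_trans _ _ _ (inv_word u ++ u ++ inv_word v)).
  by apply: pres_congr_cat; exact: rst_sym.
by rewrite catA; exact: (@pres_congr_cat _ _ [::] (inv_word v) _ _ (congr_Vword u)).
Qed.

Definition pres_inv (p : pres_group) : pres_group :=
  pres_class (R `|` free_cancel) (inv_word (pres_repr p)).

Lemma pres_mulV : left_inverse (1 : pres_group) pres_inv *%g.
Proof.
move=> p; rewrite -[X in _ * X](pres_reprK p) [LHS]pres_mulE.
exact/pres_classP/congr_Vword.
Qed.

Lemma pres_mulrV : right_inverse (1 : pres_group) pres_inv *%g.
Proof.
move=> p; rewrite -[X in X * _](pres_reprK p) [LHS]pres_mulE.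
exact/pres_classP/congr_wordV.
Qed.

HB.instance Definition _ := hasInv.Build pres_group pres_inv.
HB.instance Definition _ := Monoid_isGroup.Build pres_group pres_mulV pres_mulrV.

End GroupPresentation.

Definition monoid_isomorphic (M N : monoidType) : Prop :=
  exists f : UMagmaMorphism.type M N, bijective f.

Definition is_free_group (G : groupType) : Prop :=
  exists S : choiceType,
    monoid_isomorphic (pres_group (set0 : set (seq (S * bool) * seq (S * bool)))) G.

Definition finitely_generated (G : groupType) : Prop :=
  exists s : seq G, forall H : {pred G},
    group_closed H -> {subset s <= H} -> forall g, g \in H.

Section HNN.
Variables (A C : groupType) (i1 i2 : C -> A).

(* < A, t | ... > is the presentation with generators the elements of A
   ([Some a]) and the stable letter t ([None]); its relations are the
   multiplication table of A, which presents A itself, and the relations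
   t^-1 i1(c) t = i2(c). *)
Let elt (a : A) : option A * bool := (Some a, true).
Let t : option A * bool := (None, true).
Let tV : option A * bool := (None, false).

Definition hnn_table : set (seq (option A * bool) * seq (option A * bool)) :=
  [set r | exists a b, r = ([:: elt a; elt b], [:: elt (a * b)])].

Definition hnn_conj : set (seq (option A * bool) * seq (option A * bool)) :=
  [set r | exists c, r = ([:: tV; elt (i1 c); t], [:: elt (i2 c)])].

Definition hnn_extension : groupType := pres_group (hnn_table `|` hnn_conj).

End HNN.

Definition admits_finite_complete_rewriting_system (G : groupType) : Prop :=
  exists (X : finType) (R : set (seq X * seq X)),
    [/\ finite_set R, complete_system R & monoid_isomorphic (pres_monoid R) G].

(* Main.v *)
(** Order the words over a basis of A by the shortlex order. The least words of
    the left cosets of H = i_1(C) form a transversal closed under suffixes, and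
    so do those of K = i_2(C). A reduced word u which is not least in its coset
    uH, although its tail is, can be replaced by the least word v of uH: with
    u = v h this gives the rule u t -> v t i_2(i_1^-1(h)), and similarly for
    t^-1 and K. Together with free cancellation, the irreducible words are the
    Britton normal forms of the HNN-extension, hence are unique. The rules
    terminate because each of them deletes letters t, or else decreases in the
    shortlex order the leftmost segment between letters t that it modifies. They
    are finite in number because v^-1 u is a reduced word representing an
    element of H, and finitely generated subgroups of free groups are
    quasiconvex. *)

Require Import Defs.
From Stdlib Require Import Relation_Operators Inverse_Image.
From HB Require Import structures.
From mathcomp Require Import all_boot.
From mathcomp Require Import zify.
From mathcomp Require Import boolp classical_sets cardinality.

Set Implicit Arguments.
Unset Strict Implicit.
Unset Printing Implicit Defensive.

Local Open Scope group_scope.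

(** * Completeness from a well-founded order and a separating invariant *)

Section RewritingTheory.
Variables (X : Type) (R : set (seq X * seq X)).

Definition irreducible (x : seq X) : Prop := forall y, ~ rewrite_step R x y.

Lemma rewrite_step_cat a b x y :
  rewrite_step R x y -> rewrite_step R (a ++ x ++ b) (a ++ y ++ b).
Proof.
move=> [x1 [u [v [x2 [Ruv -> ->]]]]]; exists (a ++ x1), u, v, (x2 ++ b).
by rewrite -!catA.
Qed.

Lemma irreducible_catl x y : irreducible (x ++ y) -> irreducible x.
Proof. by move=> irr z /(@rewrite_step_cat [::] y); exact: irr. Qed.

Lemma irreducible_rule x u v y : R (u, v) -> ~ irreducible (x ++ u ++ y).
Proof. by move=> Ruv /(_ (x ++ v ++ y)); apply; exists x, u, v, y. Qed.

Variable (lt : seq X -> seq X -> Prop).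
Hypothesis lt_wf : well_founded lt.
Hypothesis step_lt : forall x y, rewrite_step R x y -> lt y x.

Lemma wf_terminating : terminating R.
Proof.
move=> [f fstep].
have H x : forall n, f n = x -> False.
  elim/(well_founded_ind lt_wf): x => x IH n fn.
  by apply: (IH (f n.+1) _ n.+1) => //; rewrite -fn; exact/step_lt/fstep.
exact: (H _ 0).
Qed.

Lemma wf_normal_form x : exists2 y, rewrites R x y & irreducible y.
Proof.
elim/(well_founded_ind lt_wf): x => x IH.
have [irr|] := pselect (irreducible x).
  by exists x => //; exact: rt_refl.
move=> /existsNP[y /contrapT xy]; have [z yz irr] := IH _ (step_lt xy).
by exists z => //; apply: rt_trans yz; exact: rt_step.
Qed.

Lemma pres_congr_rewrites x y : rewrites R x y -> pres_congr R x y.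
Proof.
elim=> {x y} [x y|x|x y z _ IH1 _ IH2]; first exact: rst_step.
  exact: rst_refl.
exact: rst_trans IH1 IH2.
Qed.

Variables (Y : Type) (ev : seq X -> Y).
Hypothesis ev_step : forall x y, rewrite_step R x y -> ev x = ev y.
Hypothesis ev_inj :
  forall x y, irreducible x -> irreducible y -> ev x = ev y -> x = y.

Lemma ev_congr x y : pres_congr R x y -> ev x = ev y.
Proof.
by elim=> {x y} [x y /ev_step|x|x y _ ->|x y z _ -> _ ->].
Qed.

Lemma unique_normal_form_complete : complete_system R.
Proof.
split=> [|x y z xy xz]; first exact: wf_terminating.
have [y' yy' irry] := wf_normal_form y; have [z' zz' irrz] := wf_normal_form z.
exists y'; split=> //; suff <- : z' = y' by [].
apply: ev_inj => //.
rewrite -(ev_congr (pres_congr_rewrites zz')).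
rewrite -(ev_congr (pres_congr_rewrites xz)).
rewrite -(ev_congr (pres_congr_rewrites yy')).
by rewrite -(ev_congr (pres_congr_rewrites xy)).
Qed.

(** Used for the injectivity of the map that [ev] induces on the presented monoid: both words
    rewrite to irreducible words, which [ev] identifies. *)
Lemma ev_pres_congr x y : ev x = ev y -> pres_congr R x y.
Proof.
move=> exy.
have [x' xx' irrx] := wf_normal_form x; have [y' yy' irry] := wf_normal_form y.
apply: (rst_trans _ _ _ x'); first exact: pres_congr_rewrites.
apply: rst_sym; suff -> : x' = y' by exact: pres_congr_rewrites.
apply: ev_inj => //; rewrite -(ev_congr (pres_congr_rewrites xx')) exy.
exact: ev_congr (pres_congr_rewrites yy').
Qed.

End RewritingTheory.

(** * Free reduction of group words *)

Section FreeReduction.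
Variable S : choiceType.
Implicit Types (l : S * bool) (w : seq (S * bool)).

Definition reduced w := sorted (fun l l' => l' != flip_letter l) w.

Definition push l w :=
  if w is l' :: w' then if l' == flip_letter l then w' else l :: w else [:: l].

Definition reduce w := foldr push [::] w.

Lemma flip_letterK : involutive (@flip_letter S).
Proof. by case=> s b; rewrite /flip_letter /= negbK. Qed.

Lemma reduced_push l w : reduced w -> reduced (push l w).
Proof.
case: w => //= l' w; case: ifP => [_ /path_sorted //|neq pw].
by rewrite /reduced /= neq.
Qed.

Lemma reduced_reduce w : reduced (reduce w).
Proof. by elim: w => //= l w; exact: reduced_push. Qed.

Lemma reduce_id w : reduced w -> reduce w = w.
Proof.
elim: w => //= l w IH pw; rewrite IH; last exact: path_sorted pw.
by case: w pw {IH} => //= l' w /andP[/negPf->].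
Qed.

(** Letters thus act on reduced words by permutations, which makes [reduce] invariant under free
    cancellation. *)
Lemma push_flip l w : reduced w -> push l (push (flip_letter l) w) = w.
Proof.
case: w => [|l' w] /=; first by rewrite eqxx.
rewrite flip_letterK; case: eqVneq => [->|neq] /=; last by rewrite eqxx.
by case: w => //= l'' w /andP[/negPf->].
Qed.

Lemma reduce_cancel x l y :
  reduce (x ++ [:: l; flip_letter l] ++ y) = reduce (x ++ y).
Proof.
rewrite /reduce !foldr_cat /=; congr foldr.
exact: push_flip (reduced_reduce y).
Qed.

Lemma mem_push l w : {subset push l w <= l :: w}.
Proof.
case: w => //= l' w; case: ifP => _ x xw //; by rewrite !in_cons xw !orbT.
Qed.

Lemma mem_reduce w : {subset reduce w <= w}.
Proof.
elim: w => //= l w IH x /mem_push; rewrite !inE => /orP[->//|/IH->].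
by rewrite orbT.
Qed.

Lemma size_reduce w : size (reduce w) < size w \/ reduce w = w.
Proof.
elim: w => /= [|l w IH]; first by right.
have le_w : size (reduce w) <= size w by case: IH => [/ltnW|->].
case E: (reduce w) IH le_w => [|l' r] /= IH le_w.
  by case: IH => [lt_w|<-]; [left|right].
case: ifP => _; first by left; lia.
by case: IH => [lt_w|<-]; [left|right].
Qed.

Lemma reduced_rcons w l :
  reduced w -> (forall w', w <> rcons w' (flip_letter l)) ->
  reduced (rcons w l).
Proof.
case/lastP: w => [//|w l'] rw neq.
have -> : rcons (rcons w l') l = w ++ l' :: [:: l] by rewrite -!cats1 -catA.
move: rw; rewrite /reduced sorted_cat_cons => -> /=; rewrite andbT.
apply/eqP => El.
by apply: (neq w); rewrite El flip_letterK.
Qed.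

Lemma reduced_inv_word w : reduced w -> reduced (inv_word w).
Proof.
rewrite /reduced /inv_word rev_sorted sorted_map; apply: sub_sorted => l l' /=.
by apply: contraNneq => /(can_inj flip_letterK)->; rewrite flip_letterK.
Qed.

(** The last letter of [inv_word v] is the inverse of the first letter of [v], so it cancels [l]
    only if [v] begins with [l]. *)
Lemma reduced_inv_word_cat v l w :
  reduced v -> reduced (l :: w) -> (forall v', v <> l :: v') ->
  reduced (inv_word v ++ l :: w).
Proof.
move=> rv rw neq; rewrite /reduced sorted_cat_cons; apply/andP; split=> //.
apply: reduced_rcons; first exact: reduced_inv_word.
(* With [l] as the default of [last], the empty [v] yields [l = flip_letter l], which the signs
   exclude. *)
case: v rv neq => [|l' v] _ neq w' /(congr1 (last l)).
  by rewrite last_rcons /=; case: l {rw neq} => s [].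
rewrite last_rcons /inv_word /= rev_cons last_rcons.
by move=> /(can_inj flip_letterK) E; apply: (neq v); rewrite E.
Qed.

End FreeReduction.

Lemma reduced_map (S T : choiceType) (f : S -> T) (w : seq (S * bool)) :
  injective f -> reduced w -> reduced [seq (f l.1, l.2) | l <- w].
Proof.
move=> f_inj; rewrite /reduced sorted_map; apply: sub_sorted => -[s b] [s' b'].
rewrite /flip_letter /=; apply: contraNneq => -[/f_inj-> ->].
by [].
Qed.

Lemma reduce_congr (S : choiceType) (w w' : seq (S * bool)) :
  pres_congr (set0 `|` free_cancel (S:=S))%classic w w' -> reduce w = reduce w'.
Proof.
elim=> {w w'} [w w'|//|//|w1 w2 w3 _ -> _ ->//].
move=> [x [u [v [y [[//|[l [-> ->]]] -> ->]]]]].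
exact: reduce_cancel.
Qed.

(** * Values of words and bases of free groups *)

Section WordValue.
Variable G : groupType.

Definition letter_val (T : Type) (b : T -> G) (l : T * bool) : G :=
  if l.2 then b l.1 else (b l.1)^-1.

Definition word_val (T : Type) (b : T -> G) (w : seq (T * bool)) : G :=
  \prod_(l <- w) letter_val b l.

Variables (T : choiceType) (b : T -> G).
Implicit Types w p r : seq (T * bool).

Lemma word_val_nil : word_val b [::] = 1.
Proof. exact: big_nil. Qed.

Lemma word_val_cons l w : word_val b (l :: w) = letter_val b l * word_val b w.
Proof. exact: big_cons. Qed.

Lemma word_val_cat w w' : word_val b (w ++ w') = word_val b w * word_val b w'.
Proof. exact: big_cat. Qed.

Lemma word_val1 l : word_val b [:: l] = letter_val b l.
Proof. by rewrite word_val_cons word_val_nil mulg1. Qed.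

Lemma letter_val_flip l : letter_val b (flip_letter l) = (letter_val b l)^-1.
Proof. by case: l => s []; rewrite /letter_val //= invgK. Qed.

Lemma word_val_inv w : word_val b (inv_word w) = (word_val b w)^-1.
Proof.
elim: w => [|l w IH]; first by rewrite word_val_nil invg1.
rewrite word_val_cons invgM -IH /inv_word /= rev_cons -cats1 word_val_cat.
by rewrite word_val1 letter_val_flip.
Qed.

Lemma word_val_push l w :
  word_val b (push l w) = letter_val b l * word_val b w.
Proof.
case: w => [|l' w] /=; first by rewrite word_val1 word_val_nil mulg1.
case: eqP => [->|_]; last by rewrite -word_val_cons.
by rewrite word_val_cons letter_val_flip mulVKg.
Qed.

Lemma word_val_reduce w : word_val b (reduce w) = word_val b w.
Proof. by elim: w => //= l w IH; rewrite word_val_push IH word_val_cons. Qed.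

(** Free reduction only deletes factors of value 1, so in a Cayley graph the path of [w] visits
    every vertex on the path of its reduced form. *)
Lemma reduce_prefix w p r : reduce w = p ++ r ->
  exists p' r', w = p' ++ r' /\ word_val b p' = word_val b p.
Proof.
elim: w p r => [|l w IH] p r /=.
  by case: p => // _; exists [::], [::].
have keep p1 r1 : reduce w = p1 ++ r1 -> exists p' r',
    l :: w = p' ++ r' /\ word_val b p' = letter_val b l * word_val b p1.
  move=> /IH[p' [r' [-> val_p']]]; exists (l :: p'), r'.
  by rewrite word_val_cons val_p'.
have split_cons w1 : reduce w = w1 -> l :: w1 = p ++ r -> exists p' r',
    l :: w = p' ++ r' /\ word_val b p' = word_val b p.
  case: p => [|l1 p] Ew; first by exists [::], (l :: w).
  by case=> <- Ew1; rewrite word_val_cons; apply: (keep _ r); rewrite Ew.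
rewrite /push; case Ew: (reduce w) => [|l' w1]; first exact: split_cons.
case: eqP => [El'|_]; last exact: split_cons.
(* Here [l] cancels [l']: the prefix [p] comes from the prefix [l' :: p] of [reduce w], and the two
   letters have product 1. *)
move=> Ew1; have [p' [r' [-> val_p']]] : exists p' r', l :: w = p' ++ r' /\
    word_val b p' = letter_val b l * word_val b (l' :: p).
  by apply: (keep _ r); rewrite Ew Ew1.
by exists p', r'; rewrite val_p' word_val_cons El' letter_val_flip mulVKg.
Qed.

Definition is_basis : Prop :=
  (forall g, exists w, word_val b w = g) /\
  (forall w w', word_val b w = word_val b w' -> reduce w = reduce w').

End WordValue.

Lemma pres_class_word_val (S : choiceType) R (w : seq (S * bool)) :
  pres_class (R `|` free_cancel (S:=S))%classic w =
  word_val (fun s => pres_class _ [:: (s, true)] : pres_group R) w.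
Proof.
elim: w => [|[s e] w IH]; first by rewrite word_val_nil.
rewrite word_val_cons -IH -cat1s -pres_mulE; congr (_ * _).
case: e => //=; apply: (@mulgI (pres_group R) (pres_class _ [:: (s, true)])).
rewrite [RHS]mulgV [LHS]pres_mulE; apply/pres_classP/rst_step.
exists [::], [:: (s, true); (s, false)], [::], [::]; split=> //.
by right; exists (s, true).
Qed.

Lemma free_group_basis (G : groupType) :
  is_free_group G -> exists (S : choiceType) (b : S -> G), is_basis b.
Proof.
move=> [S [f [g fK gK]]].
have val_f w : word_val (fun s => f (pres_class _ [:: (s, true)])) w =
    f (pres_class _ w).
  rewrite pres_class_word_val /word_val.
  elim: w => [|[s e] w IH]; first by rewrite !big_nil gmulf1.
  rewrite !big_cons gmulfM -IH; congr (_ * _); case: e => //.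
  apply: (@mulgI G (f (pres_class _ [:: (s, true)]))).
  by rewrite mulgV -gmulfM mulgV gmulf1.
exists S, (fun s => f (pres_class _ [:: (s, true)])); split=> [x|w w'].
  by exists (pres_repr (g x)); rewrite val_f pres_reprK gK.
by rewrite !val_f => /(can_inj fK)/pres_classP; exact: reduce_congr.
Qed.

(** Finitely many basis elements [S0] occur in words for the generators. They exhaust the basis: a
    word over [S0] with value [b x] has reduced form [x], and reduction creates no new letters. *)
Lemma free_fg_finite_basis (G : groupType) : is_free_group G ->
  finitely_generated G -> exists (I : finType) (b : I -> G), is_basis b.
Proof.
move=> /free_group_basis[S [b [b_surj b_inj]]] [s gen_s].
have [word wordK] := choice b_surj.
pose S0 := [seq l.1 | l <- flatten [seq word g | g <- s]].
have S0_gen g : exists2 w, word_val b w = g & {in w, forall l, l.1 \in S0}.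
  pose H := [pred g | `[< exists2 w, word_val b w = g &
    {in w, forall l, l.1 \in S0} >]].
  suff /asboolP : g \in H by [].
  apply: gen_s => [|x xs].
    split; first by apply/asboolP; exists [::]; rewrite ?word_val_nil.
    move=> _ _ /asboolP[u <- uS0] /asboolP[v <- vS0].
    apply/asboolP; exists (u ++ inv_word v).
      by rewrite word_val_cat word_val_inv.
    move=> l; rewrite mem_cat /inv_word mem_rev => /orP[/uS0//|].
    by move=> /mapP[l' /vS0 + ->].
  apply/asboolP; exists (word x) => // l lx; apply: map_f.
  by apply/flattenP; exists (word x) => //; exact: map_f.
have S0_all x : x \in S0.
  have [w val_w wS0] := S0_gen (b x).
  apply: (wS0 (x, true)); apply: mem_reduce.
  rewrite (b_inj w [:: (x, true)]) ?inE //.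
  by rewrite word_val1.
exists (seq_sub S0), (fun x => b (ssval x)).
have val_S0 w : word_val (fun x : seq_sub S0 => b (ssval x)) w =
    word_val b [seq (ssval l.1, l.2) | l <- w].
  by rewrite /word_val big_map.
split=> [g|w w'].
  have [w <-] := b_surj g; exists [seq (SeqSub (S0_all l.1), l.2) | l <- w].
  by rewrite val_S0 -map_comp map_id_in // => -[].
rewrite -(word_val_reduce _ w) -(word_val_reduce _ w') !val_S0 => /b_inj.
rewrite !(reduce_id (reduced_map val_inj (reduced_reduce _))).
by apply: inj_map => -[x e] [y e'] /= [/val_inj-> ->].
Qed.

(** * The shortlex order as a comparison of numbers *)

Section Shortlex.
Variable L : finType.
Implicit Types (l : L) (u v w : seq L).

Definition base := #|L|.+1.
Definition digit l := (enum_rank l).+1.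

(* Digits are nonzero and below the base, so comparing ranks is comparing
   words in the shortlex order. *)
Definition rank_from n w := foldl (fun n l => n * base + digit l)%N n w.
Definition rank w := rank_from 0 w.

Lemma digit_lt_base l : digit l < base.
Proof. by rewrite /digit /base ltnS. Qed.

Lemma rank_fromE n w : rank_from n w = (n * base ^ size w + rank w)%N.
Proof.
rewrite /rank; elim/last_ind: w => [|w l IH]; first by rewrite muln1 addn0.
by rewrite /rank_from !foldl_rcons -!/(rank_from _ _) IH size_rcons expnS; lia.
Qed.

Lemma rank_from_cat n u v :
  rank_from n (u ++ v) = rank_from (rank_from n u) v.
Proof. exact: foldl_cat. Qed.

Lemma rank_cat u v : rank (u ++ v) = (rank u * base ^ size v + rank v)%N.
Proof. by rewrite /rank rank_from_cat rank_fromE. Qed.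

Lemma rank_rcons w l : rank (rcons w l) = (rank w * base + digit l)%N.
Proof. by rewrite /rank /rank_from foldl_rcons. Qed.

Lemma rank_lt_expn w : rank w < base ^ size w.
Proof.
elim/last_ind: w => [//|w l IH]; rewrite rank_rcons size_rcons expnS.
have := digit_lt_base l; nia.
Qed.

(** The leading digit of the longer word is nonzero, so its rank is at least [base ^ size u], which
    exceeds [rank u]. *)
Lemma rank_size u v : size u < size v -> rank u < rank v.
Proof.
case: v => //= l v lt_uv; have := rank_lt_expn u.
rewrite -cat1s rank_cat (_ : rank [:: l] = digit l) //.
have : base ^ size u <= base ^ size v by rewrite leq_pexp2l.
by rewrite /digit mulSn; lia.
Qed.

Lemma size_rank u v : rank u <= rank v -> size u <= size v.
Proof. by apply: contraLR; rewrite -!ltnNge; exact: rank_size. Qed.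

(** The last digit is the remainder modulo [base]; nonzero digits separate the empty word from the
    others. *)
Lemma rank_inj : injective rank.
Proof.
move=> u; elim/last_ind: u => [|u l IH] v; case/lastP: v => [|v l'] //;
  rewrite ?rank_rcons; try by rewrite /rank /digit /=; lia.
move=> E.
have El : digit l = digit l'.
  move/(congr1 (modn^~ base)): E.
  by rewrite !modnMDl !modn_small ?digit_lt_base.
have/IH-> : rank u = rank v.
  by move: E; rewrite El => /addIn/eqP; rewrite eqn_pmul2r // => /eqP.
by case: El => /val_inj/enum_rank_inj->.
Qed.

Lemma rank_from_lt n u v : rank u < rank v -> rank_from n u < rank_from n v.
Proof.
move=> lt_uv; rewrite !rank_fromE.
have : base ^ size u <= base ^ size v.
  by rewrite leq_pexp2l //; exact/size_rank/ltnW.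
by nia.
Qed.

Lemma rank_catl w u v : rank u < rank v -> rank (w ++ u) < rank (w ++ v).
Proof. by rewrite /rank !rank_from_cat; exact: rank_from_lt. Qed.

End Shortlex.

(** * Minimal coset representatives and quasiconvexity *)

Section MinimalCosetWords.
Variables (A C : groupType) (i : C -> A).
Hypothesis iM : {morph i : x y / x * y}.

Lemma morph1 : i 1 = 1.
Proof. by apply: (@mulgI A (i 1)); rewrite -iM !mulg1. Qed.

Lemma morphV : {morph i : x / x^-1}.
Proof. by move=> x; apply: (@mulgI A (i x)); rewrite -iM !mulgV morph1. Qed.

Variables (I : finType) (b : I -> A).
Local Notation val := (word_val b).
Implicit Types (u v w p q r : seq (I * bool)).

Definition coset_minimal w :=
  forall w' c, val w = val w' * i c -> rank w <= rank w'.

Lemma coset_minimal_eq v w c :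
  coset_minimal v -> coset_minimal w -> val v = val w * i c -> v = w.
Proof.
move=> min_v min_w E; apply: rank_inj; apply/eqP; rewrite eqn_leq (min_v _ _ E).
by apply: (min_w _ c^-1); rewrite E -mulgA -iM mulgV morph1 mulg1.
Qed.

Lemma coset_minimal_nil : coset_minimal [::].
Proof. by []. Qed.

(** Left multiplication by [l] maps left cosets to left cosets, and prepending [l] preserves the
    shortlex order. *)
Lemma coset_minimal_behead l w : coset_minimal (l :: w) -> coset_minimal w.
Proof.
move=> min_w w' c E; rewrite leqNgt; apply/negP => /(@rank_catl _ [:: l]).
apply/negP; rewrite -leqNgt; apply: (min_w _ c).
by rewrite !word_val_cons E mulgA.
Qed.

Lemma coset_minimal_reduced w : coset_minimal w -> reduced w.
Proof.
move=> min_w; have [/rank_size lt_w|<-] := size_reduce w.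
  have /min_w : val w = val (reduce w) * i 1.
    by rewrite word_val_reduce morph1 mulg1.
  by rewrite leqNgt lt_w.
exact: reduced_reduce.
Qed.

Hypothesis basis_b : is_basis b.

Lemma coset_minimal_exists a :
  exists wc, val wc.1 * i wc.2 = a /\ coset_minimal wc.1.
Proof.
have [w0 w0a] := basis_b.1 a.
pose P n := `[< exists wc, val wc.1 * i wc.2 = a /\ rank wc.1 = n >].
have exP : exists n, P n.
  by exists (rank w0); apply/asboolP; exists (w0, 1); rewrite morph1 mulg1.
have /ex_minnP[n /asboolP[[w c] /= [wca wn]] min_n] := exP.
exists (w, c); split=> // w' c' E; rewrite /= wn; apply: min_n.
by apply/asboolP; exists (w', c' * c); rewrite iM mulgA -E.
Qed.

Hypothesis fgC : finitely_generated C.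

(* Quasiconvexity: in the Cayley tree, the geodesic from 1 to an element of the
   subgroup is covered by any path joining them, in particular by a product of
   generators, which stays close to the subgroup. *)
Lemma fg_quasiconvex : exists N, forall p r c,
  reduced (p ++ r) -> val (p ++ r) = i c ->
  exists q c', size q <= N /\ val p = i c' * val q.
Proof.
have [s gen_s] := fgC; have [word wordK] := choice basis_b.1.
pose N := \max_(c <- s) size (word (i c)); exists N.
pose close p := exists q c', size q <= N /\ val p = i c' * val q.
pose H := [pred c | `[< exists w, val w = i c /\
  forall p r, w = p ++ r -> close p >]].
have closeM p c : close p -> forall w, val w = i c * val p -> close w.
  by move=> [q [c' [qN E]]] w Ew; exists q, (c * c'); rewrite Ew E mulgA iM.
have H_all c : c \in H.
  apply: gen_s => [|x xs].
    split.
      apply/asboolP; exists [::]; rewrite morph1 word_val_nil; split=> // p r.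
      by case: p => // _; exists [::], 1; rewrite morph1 mul1g.
    move=> x y /asboolP[u [ux uclose]] /asboolP[v [vy vclose]].
    apply/asboolP; exists (u ++ inv_word v); split=> [|p r].
      by rewrite word_val_cat word_val_inv ux vy iM morphV.
    case: (leqP (size p) (size u)) => [le_pu|lt_up] E.
      apply: (uclose _ (drop (size p) u)).
      rewrite -[LHS](cat_take_drop (size p)); congr (_ ++ _).
      by move/(congr1 (take (size p))): E; rewrite takel_cat // take_size_cat.
    (* Beyond [u] the path runs backwards along that of [v], translated by [i (x / y)], so closeness
       is inherited from a prefix of [v]. *)
    have Ep : p = u ++ take (size p - size u) (inv_word v).
      move/(congr1 (take (size p))): E.
      by rewrite take_cat ltnNge (ltnW lt_up) /= take_size_cat.
    set p' := take _ _ in Ep; set r' := drop (size p - size u) (inv_word v).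
    have Ev : v = inv_word r' ++ inv_word p'.
      rewrite -[v]inv_wordK.
      rewrite -(cat_take_drop (size p - size u) (inv_word v)).
      by rewrite /inv_word map_cat rev_cat.
    apply: (closeM _ (x / y) (vclose _ _ Ev)).
    rewrite Ep word_val_cat ux iM morphV -vy Ev word_val_cat -mulgA.
    congr (_ * _).
    by rewrite invgM !word_val_inv !invgK mulgK.
  apply/asboolP; exists (word (i x)); split=> // p r E; exists p, 1.
  rewrite morph1 mul1g; split=> //.
  apply: (@leq_trans (size (word (i x)))); first by rewrite E size_cat leq_addr.
  exact: (leq_bigmax_seq (F := fun c => size (word (i c)))).
move=> p r c red_pr val_pr; have /asboolP[w [wc wclose]] := H_all c.
have red_w : reduce w = p ++ r.
  by rewrite -(reduce_id red_pr); apply: basis_b.2; rewrite wc val_pr.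
have [p' [r' [Ew Ep]]] := reduce_prefix b red_w.
by have [q [c' [qN E]]] := wclose _ _ Ew; exists q, c'; rewrite -Ep.
Qed.

(** Followed by a stable letter, these words are the left-hand sides of the pushing rules. The
    condition on the tail is what bounds their length. *)
Definition almost_minimal u :=
  [/\ reduced u, ~ coset_minimal u & coset_minimal (behead u)].

Lemma almost_minimal_suffix w : reduced w -> ~ coset_minimal w ->
  exists x u, w = x ++ u /\ almost_minimal u.
Proof.
elim: w => [|l w IH] red_w not_min; first by case: not_min.
have [min_w|/(IH (path_sorted red_w))[x [u [-> bad_u]]]] :=
  pselect (coset_minimal w); first by exists [::], (l :: w).
by exists (l :: x), u.
Qed.

(* If v is the minimal representative of the coset of u, then v^-1 u is a
   reduced word representing an element of the subgroup. *)
Lemma almost_minimal_bounded :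
  exists N, forall u, almost_minimal u -> size u <= N.
Proof.
have [N qc] := fg_quasiconvex.
exists N.+1 => -[//|l w] [red_lw not_min /= min_w].
have [[v c] [/= Evc min_v]] := coset_minimal_exists (val (l :: w)).
(* If [v] began with [l], then its tail and [w] would be minimal words of the same coset, hence
   equal, and [l :: w] would be minimal. *)
have neq v' : v <> l :: v'.
  move=> Ev; apply: not_min; suff -> : w = v' by rewrite -Ev.
  apply: (@coset_minimal_eq _ _ c) => //.
    by apply: (@coset_minimal_behead l); rewrite -Ev.
  by apply: (@mulgI A (letter_val b l)); rewrite mulgA -!word_val_cons -Ev.
have red := reduced_inv_word_cat (coset_minimal_reduced min_v) red_lw neq.
rewrite -cat_rcons in red.
have Ec : val (rcons (inv_word v) l ++ w) = i c.
  by rewrite cat_rcons word_val_cat word_val_inv -Evc mulKg.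
(* Quasiconvexity is applied at the vertex just before [w]. It puts [inv_word q] in the coset of
   [w], so the minimal word [w] is no longer than [q]; the letter [l] accounts for the successor in
   [N.+1]. *)
have [q [c' [qN Eq]]] := qc _ _ _ red Ec.
rewrite /= ltnS; apply: leq_trans (qN).
have -> : size q = size (inv_word q) by rewrite /inv_word size_rev size_map.
apply/size_rank/(min_w _ (c'^-1 * c)).
apply: (@mulgI A (val (rcons (inv_word v) l))).
by rewrite -word_val_cat Ec Eq word_val_inv mulgA mulgK -iM mulVKg.
Qed.

End MinimalCosetWords.

(** * Sequences of numbers ordered by length, then lexicographically *)

Section LexicographicOrder.
Implicit Types s t : seq nat.

Fixpoint lexn s t : bool :=
  match s, t with
  | m :: s', n :: t' => (m < n) || (m == n) && lexn s' t'
  | _, _ => false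
  end.

Definition size_lex s t : Prop :=
  size s < size t \/ size s = size t /\ lexn s t.

Lemma size_lex_cat p s t : size_lex s t -> size_lex (p ++ s) (p ++ t).
Proof.
rewrite /size_lex !size_cat ltn_add2l => -[|[-> lex_st]]; first by left.
by right; split=> //; elim: p => //= n p ->; rewrite eqxx orbT.
Qed.

(** For a fixed length, accessibility follows by induction on the length, then on the head, then on
    the accessible tail; an outer induction on the length finishes. *)
Lemma size_lex_wf : well_founded size_lex.
Proof.
have lex_acc k s : size s = k ->
    Acc (fun s t => size s = size t /\ lexn s t) s.
  elim: k s => [|k IHk] [|n s] size_s; [|by []|by []|].
    by apply: Acc_intro => -[|m t] [_].
  case: size_s; elim/ltn_ind: n s => n IHn s size_s.
  have acc_s := IHk _ size_s.
  elim: acc_s size_s => {}s _ IHs size_s; apply: Acc_intro => -[|m t] [].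
    by [].
  case=> size_t /= /orP[lt_mn|/andP[/eqP-> lex_ts]].
    by apply: (IHn _ lt_mn); rewrite size_t.
  by apply: IHs; rewrite // size_t.
move=> s; have [k] := ubnP (size s); elim: k s => [s|k IHk s].
  by [].
rewrite ltnS => le_sk; have acc_s := lex_acc _ s erefl.
elim: acc_s le_sk => {}s _ IHs le_sk.
apply: Acc_intro => t [lt_ts|[eq_ts lex_ts]].
  by apply: IHk; exact: leq_trans lt_ts le_sk.
by apply: IHs; [split | rewrite eq_ts].
Qed.

End LexicographicOrder.

Lemma bijective_monoid_isomorphic (M N : monoidType) (f : M -> N) :
  f 1 = 1 -> {morph f : x y / x * y} -> injective f ->
  (forall y, exists x, f x = y) -> monoid_isomorphic M N.
Proof.
move=> f1 fM f_inj /choice[g gK].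
pose fm := isUMagmaMorphism.Build M N f (conj f1 fM).
pose F : UMagmaMorphism.type M N := HB.pack f fm.
by exists F; exists g => // x; apply: f_inj; rewrite gK.
Qed.

(** * The rules for the HNN-extension and their finiteness *)

Section HNNRewriting.
Variables (A C : groupType) (i : bool -> C -> A).
Hypothesis iM : forall e, {morph i e : x y / x * y}.
Hypothesis i_inj : forall e, injective (i e).
Variables (I : finType) (b : I -> A).
Hypothesis basis_b : is_basis b.
Local Notation L := (I * bool)%type.
Local Notation X := (option I * bool)%type.
Local Notation val := (word_val b).
Local Notation minimal e := (coset_minimal (i e) b).

Variable rep : bool -> A -> seq L * C.
Hypothesis rep_val : forall e a, val (rep e a).1 * i e (rep e a).2 = a.
Hypothesis rep_min : forall e a, minimal e (rep e a).1.
Variable nf : A -> seq L.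
Hypothesis nf_val : forall a, val (nf a) = a.
Hypothesis nf_reduced : forall a, reduced (nf a).

Lemma nf_eq w : reduced w -> nf (val w) = w.
Proof.
move=> red_w; rewrite -[LHS](reduce_id (nf_reduced _)) -[RHS](reduce_id red_w).
by apply: basis_b.2; rewrite nf_val.
Qed.

(** Minimal words form a transversal, which fixes [v]; injectivity of [i e] then fixes [c]. *)
Lemma rep_eq e v c : minimal e v -> rep e (val v * i e c) = (v, c).
Proof.
move=> min_v; have := rep_val e (val v * i e c).
have := @rep_min e (val v * i e c).
case: (rep _ _) => v' c' /= min_v' E.
have Ev : v' = v.
  apply: (coset_minimal_eq (iM e) (c := c / c') min_v' min_v).
  by rewrite iM (morphV (iM e)) mulgA -E mulgK.
by move: E; rewrite Ev => /mulgI/i_inj->.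
Qed.

Definition letters (w : seq L) : seq X := [seq (Some l.1, l.2) | l <- w].

Lemma letters_cat u v : letters (u ++ v) = letters u ++ letters v.
Proof. exact: map_cat. Qed.

(* The stable letter t is [(None, true)], so that i_e(c) t^e = t^e i_(~e)(c). *)
Definition push_rules : set (seq X * seq X) :=
  [set r | exists e u, almost_minimal (i e) b u /\
    r = (letters u ++ [:: (None, e)],
         letters (rep e (val u)).1 ++ (None, e) ::
           letters (nf (i (~~ e) (rep e (val u)).2)))]%classic.

Definition hnn_rules : set (seq X * seq X) :=
  (push_rules `|` free_cancel (S:=option I))%classic.

Lemma hnn_rules_finite : finitely_generated C -> finite_set hnn_rules.
Proof.
move=> fgC; rewrite /hnn_rules finite_setU; split.
  have [N1 bound1] := almost_minimal_bounded (iM true) basis_b fgC.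
  have [N0 bound0] := almost_minimal_bounded (iM false) basis_b fgC.
  pose N := maxn N1 N0.
  pose rule (eu : bool * {bseq N of L}) :=
    (letters eu.2 ++ [:: (None, eu.1)],
     letters (rep eu.1 (val eu.2)).1 ++ (None, eu.1) ::
       letters (nf (i (~~ eu.1) (rep eu.1 (val eu.2)).2))).
  apply: (@sub_finite_set _ _ [set rule eu | eu in setT]%classic); last first.
    exact/finite_image/finite_finset.
  move=> _ [e [u [bad_u ->]]].
  have le_uN : size u <= N.
    by rewrite leq_max; case: e bad_u => [/bound1->|/bound0->]; rewrite ?orbT.
  by exists (e, Bseq le_uN).
apply: (@sub_finite_set _ _
    [set ([:: l; flip_letter l], [::] : seq X) | l in [set: X]]%classic).
  by move=> _ [l ->]; exists l.
exact/finite_image/finite_finset.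
Qed.

(** * Termination *)

Fixpoint segment_ranks n (W : seq X) : seq nat :=
  match W with
  | [::] => [:: n]
  | (Some s, e) :: W' => segment_ranks (rank_from n [:: (s, e)]) W'
  | (None, _) :: W' => n :: segment_ranks 0 W'
  end.

Lemma segment_ranks_letters n u W :
  segment_ranks n (letters u ++ W) = segment_ranks (rank_from n u) W.
Proof. by elim: u n => //= -[s e] u IH n; rewrite IH. Qed.

Lemma segment_ranks_catl n W : exists s n', forall W',
  segment_ranks n (W ++ W') = s ++ segment_ranks n' W'.
Proof.
elim: W n => [|[[s|] e] W IH] n /=; first by exists [::], n.
  exact: IH.
by have [s [n' E]] := IH 0; exists (n :: s), n' => W'; rewrite E.
Qed.

Lemma segment_ranks_lt m n W :
  m < n -> size_lex (segment_ranks m W) (segment_ranks n W).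
Proof.
elim: W m n => [|[[s|] e] W IH] m n lt_mn /=.
- by right; rewrite /= lt_mn.
- by apply: IH; rewrite ltn_add2r ltn_pmul2r.
- by right; rewrite /= lt_mn.
Qed.

Lemma size_segment_ranks m n W :
  size (segment_ranks m W) = size (segment_ranks n W).
Proof. by elim: W m n => [|[[s|] e] W IH] m n //=. Qed.

Lemma rep_rank_lt e u : ~ minimal e u -> rank (rep e (val u)).1 < rank u.
Proof.
move=> not_min; have min_v := @rep_min e (val u); have E := rep_val e (val u).
rewrite ltn_neqAle; apply/andP; split.
  by apply/eqP => /rank_inj Eu; apply: not_min; rewrite -Eu.
apply: (min_v _ (rep e (val u)).2^-1).
by rewrite (morphV (iM e)) -[X in _ = X * _]E mulgK.
Qed.

Definition hnn_lt (W W' : seq X) : Prop :=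
  size_lex (segment_ranks 0 W) (segment_ranks 0 W').

Lemma hnn_lt_wf : well_founded hnn_lt.
Proof. exact: (Inverse_Image.wf_inverse_image _ _ _ _ size_lex_wf). Qed.

(** A pushing rule keeps the number of segments and lowers the rank of the one before the stable
    letter; the growth of the next one is harmless lexicographically. Cancelling base letters lowers
    the rank of their segment, and cancelling stable letters leaves fewer segments. *)
Lemma hnn_step_lt W W' : rewrite_step hnn_rules W W' -> hnn_lt W' W.
Proof.
move=> [x [u [v [y [Ruv -> ->]]]]]; rewrite /hnn_lt.
have [s [n E]] := segment_ranks_catl 0 x; rewrite !{}E; apply: size_lex_cat.
case: Ruv => [[e [w [[_ not_min _] [-> ->]]]]|[[[l|] e] [-> ->]]].
- rewrite -!catA !segment_ranks_letters /=; right; split.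
    by rewrite /= segment_ranks_letters (size_segment_ranks _ 0).
  by rewrite /= rank_from_lt //; exact: rep_rank_lt.
- apply: segment_ranks_lt; rewrite /rank_from /=.
  by rewrite /base /digit; nia.
- by left; rewrite /= !ltnS (size_segment_ranks _ 0).
Qed.

(** * The action on Britton normal forms *)

Local Notation stack := (seq (seq L * bool)).
Local Notation state := (stack * A)%type.

Definition top_is e (st : stack) :=
  if st is (_, e') :: _ then e' == e else false.

(* The state ([:: (v_n, e_n); ...; (v_1, e_1)], a) stands for the element
   v_1 t^e_1 ... v_n t^e_n a; [cross e] multiplies it by t^e on the right. *)
Definition cross e (s : state) : state :=
  let: (v, c) := rep e s.2 in
  if (v == [::]) && top_is (~~ e) s.1
  then (behead s.1, val (head ([::], e) s.1).1 * i (~~ e) c)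
  else ((v, e) :: s.1, i (~~ e) c).

(** Only the empty word needs to be excluded between t^(-e) and t^e: it is the minimal word of the
    subgroup itself, so every pinch takes this form. *)
Fixpoint britton (st : stack) : Prop :=
  if st is (v, e) :: st' then
    [/\ minimal e v, ~~ ((v == [::]) && top_is (~~ e) st') & britton st']
  else True.

Lemma britton_cross e s : britton s.1 -> britton (cross e s).1.
Proof.
case: s => st a /= valid_st; rewrite /cross /=.
have := @rep_min e a; case: (rep e a) => v c /= min_v.
case: ifP => [_|/negbT]; last by split.
by case: st valid_st => [//|[v' e'] st] [].
Qed.

(** After a push, the new base element lies in the subgroup for [~~ e], so its representative is
    empty and crossing back pops. After a pop, the [britton] condition on the removed pair forces
    crossing back to push it again. *)
Lemma crossK e s : britton s.1 -> cross (~~ e) (cross e s) = s.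
Proof.
case: s => st a /= valid_st; rewrite /cross /=.
have := rep_val e a; have := @rep_min e a.
case: (rep e a) => v c /= min_v Ea; case: ifP => [|_]; last first.
  have := rep_eq c (@coset_minimal_nil _ _ (i (~~ e)) _ b).
  by rewrite word_val_nil mul1g => -> /=; rewrite negbK !eqxx Ea.
case/andP=> /eqP v0.
case: st valid_st => // -[v' e'] st /= [min_v' irr _] /eqP Ee'.
rewrite {}Ee' negbK in min_v' irr *; rewrite rep_eq // (negPf irr).
by rewrite -Ea v0 word_val_nil mul1g.
Qed.

Lemma cross_mul e st a c :
  cross e (st, a * i e c) =
  ((cross e (st, a)).1, (cross e (st, a)).2 * i (~~ e) c).
Proof.
rewrite /cross /=; have := rep_val e a; have := @rep_min e a.
case: (rep e a) => v c' /= min_v <-; rewrite -mulgA -iM rep_eq //.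
by case: ifP => _ /=; rewrite iM ?mulgA.
Qed.

Definition act_letter (s : state) (l : option A * bool) : state :=
  match l.1 with
  | Some a => (s.1, s.2 * (if l.2 then a else a^-1))
  | None => cross l.2 s
  end.

Definition act s w := foldl act_letter s w.

Lemma act_cat s u v : act s (u ++ v) = act (act s u) v.
Proof. exact: foldl_cat. Qed.

Lemma britton_act s w : britton s.1 -> britton (act s w).1.
Proof.
elim: w s => //= -[[a|] e] w IH s valid_s; apply: IH => //.
exact: britton_cross.
Qed.

Local Notation relators :=
  (@hnn_table A `|` hnn_conj (i true) (i false))%classic.
Local Notation G := (hnn_extension (i true) (i false)).

(** This is van der Waerden's method: an action of the group on normal forms proves their uniqueness
    without an analysis of critical pairs. *)
Lemma act_congr u v :
  pres_congr (relators `|` free_cancel (S:=option A))%classic u v ->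
  forall s, britton s.1 -> act s u = act s v.
Proof.
elim=> {u v} [u v|//|u v _ IH s valid_s|u v w _ IHu _ IHv s valid_s];
  last 2 first.
- by rewrite IH.
- by rewrite IHu ?IHv.
move=> [x [u' [v' [y [Ruv -> ->]]]]] s valid_s; rewrite !act_cat.
congr act; move: (act s x) (britton_act x valid_s) => {valid_s} {}s valid_s.
case: Ruv => [[[a [a' [-> ->]]]|[c [-> ->]]]|[[[a|] e] [-> ->]]].
- by rewrite /act /act_letter /= mulgA.
(* The factor [i true c] is carried across t, where it becomes [i false c]; the crossings by t^-1
   and t then cancel. *)
- rewrite /act /act_letter /= (cross_mul true) -surjective_pairing.
  by rewrite (crossK false).
- case: s valid_s => st x' /= _; rewrite /act /act_letter /=.
  by case: e; rewrite /= ?mulgK ?mulgVK.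
- exact: crossK.
Qed.

Fixpoint stack_word (st : stack) : seq X :=
  if st is (v, e) :: st' then stack_word st' ++ letters v ++ [:: (None, e)]
  else [::].

Definition state_word (s : state) := stack_word s.1 ++ letters (nf s.2).

Definition hnn_letters (W : seq X) : seq (option A * bool) :=
  [seq (omap b l.1, l.2) | l <- W].

Lemma free_cancel_reducible x l y :
  ~ irreducible hnn_rules (x ++ [:: l; flip_letter l] ++ y).
Proof. by apply: irreducible_rule; right; exists l. Qed.

(** Each letter of an irreducible word is merely appended to the word of the state, since any other
    behaviour would expose the left-hand side of a rule. *)
Lemma state_word_act W : irreducible hnn_rules W ->
  state_word (act ([::], 1) (hnn_letters W)) = W.
Proof.
elim/last_ind: W => [|W l IH] irr_Wl.
  by rewrite /state_word /= -(word_val_nil b) nf_eq.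
have irr_W : irreducible hnn_rules W.
  by apply: (irreducible_catl (y := [:: l])); rewrite cats1.
move: (IH irr_W) => {irr_W} {}IH.
rewrite /hnn_letters map_rcons -/(hnn_letters W) -cats1 act_cat.
move: (act ([::], 1) (hnn_letters W)) IH irr_Wl => -[st a] <- irr_Wl.
rewrite /state_word /= in irr_Wl *.
case: l irr_Wl => [[j|] e] irr_Wl /=.
  have -> : nf (a * (if e then b j else (b j)^-1)) = rcons (nf a) (j, e).
    rewrite -[in LHS](nf_val a) -[if e then _ else _]/(letter_val b (j, e)).
    rewrite -word_val1 -word_val_cat cats1 nf_eq // reduced_rcons // => w Ew.
    move: irr_Wl; rewrite Ew -cats1 -cats1 letters_cat /= -!catA /=.
    rewrite catA -[[:: _; _]]cats0.
    have := @free_cancel_reducible (stack_word st ++ letters w)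
      (Some j, ~~ e) [::].
    by rewrite /flip_letter /= negbK.
  by rewrite -!cats1 letters_cat -!catA.
(* Otherwise an almost minimal suffix of [nf a], followed by the stable letter, could be
   rewritten. *)
have min_a : minimal e (nf a).
  apply: contrapT => /(almost_minimal_suffix (nf_reduced a))[x [u [Ea bad_u]]].
  move: irr_Wl; rewrite Ea letters_cat -cats1 -!catA [stack_word _ ++ _]catA.
  rewrite -[letters u ++ _]cats0.
  apply: irreducible_rule; left; exists e, u; split=> //.
rewrite /act_letter /= /cross /=.
have -> : rep e a = (nf a, 1).
  by rewrite -[in LHS](nf_val a) -[val _]mulg1 -(morph1 (iM e)) rep_eq.
rewrite (morph1 (iM _)) /=; case: ifP => [/andP[/eqP a0 top_st]|_]; last first.
  by rewrite -[in nf 1](word_val_nil b) nf_eq //= cats0 -cats1 -!catA.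
(* A pop is impossible, as the word would end in t^(-e) t^e. *)
case: st irr_Wl top_st => // -[v e'] st irr_Wl /eqP /= Ee'; case: notF.
move: irr_Wl; rewrite a0 Ee' /= cats0 -cats1 -!catA catA.
have := @free_cancel_reducible (stack_word st ++ letters v) (None, ~~ e) [::].
by rewrite /flip_letter /= negbK.
Qed.

(** * The isomorphism with the HNN-extension *)

Definition hnn_value (W : seq X) : G := pres_class _ (hnn_letters W).

(** Equal elements send the trivial state to the same state, from which the irreducible word can be
    read off. *)
Lemma hnn_value_inj W W' :
  irreducible hnn_rules W -> irreducible hnn_rules W' ->
  hnn_value W = hnn_value W' -> W = W'.
Proof.
move=> irr irr' /pres_classP/act_congr E.
by rewrite -(state_word_act irr) -(state_word_act irr') E.
Qed.

Definition hnn_base (a : A) : G := pres_class _ [:: (Some a, true)].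
Definition hnn_generator (o : option I) : G :=
  pres_class _ [:: (omap b o, true)].

Lemma hnn_valueE W : hnn_value W = word_val hnn_generator W.
Proof. by rewrite /hnn_value pres_class_word_val /word_val big_map. Qed.

Lemma hnn_baseM : {morph hnn_base : x y / x * y}.
Proof.
move=> x y; rewrite [RHS]pres_mulE; apply/pres_classP/rst_sym/rst_step.
exists [::], [:: (Some x, true); (Some y, true)].
exists [:: (Some (x * y), true)], [::].
by split=> //; left; left; exists x, y.
Qed.

Lemma hnn_value_letters w : hnn_value (letters w) = hnn_base (val w).
Proof.
rewrite hnn_valueE; elim: w => [|[j e] w IH] /=.
  by rewrite !word_val_nil (morph1 hnn_baseM).
rewrite !word_val_cons hnn_baseM IH; congr (_ * _); case: e => //.
by rewrite [RHS](morphV hnn_baseM).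
Qed.

Lemma hnn_base_stable e c :
  hnn_base (i e c) * letter_val hnn_generator (None, e) =
  letter_val hnn_generator (None, e) * hnn_base (i (~~ e) c).
Proof.
pose t := hnn_generator None.
have E : t^-1 * hnn_base (i true c) * t = hnn_base (i false c).
  (* The inverse of t is turned into the class of the formal inverse letter, so that the product
     becomes the class of one word. *)
  rewrite -[t^-1]/(letter_val hnn_generator (None, false)).
  rewrite -word_val1 -hnn_valueE.
  rewrite [LHS](etrans (congr1 (fun x => x * t) (pres_mulE _ _ _))
    (pres_mulE _ _ _)).
  apply/pres_classP/rst_step.
  exists [::], [:: (None, false); (Some (i true c), true); (None, true)].
  exists [:: (Some (i false c), true)], [::]; split=> //.
  by left; right; exists c.
case: e; rewrite /letter_val /= -/t -E -?mulgA ?mulVKg //.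
by rewrite mulgV mulg1.
Qed.

Lemma hnn_value_step W W' :
  rewrite_step hnn_rules W W' -> hnn_value W = hnn_value W'.
Proof.
move=> [x [u [v [y [Ruv -> ->]]]]]; rewrite !hnn_valueE !word_val_cat.
congr (_ * (_ * _)).
case: Ruv => [[e [w [_ [-> ->]]]]|[l [-> ->]]]; last first.
  by rewrite word_val_cons word_val1 letter_val_flip mulgV word_val_nil.
rewrite !word_val_cat !word_val_cons word_val_nil mulg1 -!hnn_valueE.
rewrite !hnn_value_letters nf_val -hnn_base_stable mulgA -hnn_baseM.
by rewrite rep_val.
Qed.

Lemma hnn_value_surj g : exists W, hnn_value W = g.
Proof.
rewrite -[g](pres_reprK g) pres_class_word_val.
elim: (pres_repr g) => [|l w [W EW]].
  by exists [::]; rewrite hnn_valueE !word_val_nil.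
have [V EV] : exists V, hnn_value V =
    letter_val (fun o : option A => pres_class _ [:: (o, true)] : G) l.
  case: l => [[a|] e]; last first.
    by exists [:: (None, e)]; rewrite hnn_valueE word_val1.
  exists (letters (nf (if e then a else a^-1))).
  rewrite hnn_value_letters nf_val.
  by case: e => //; rewrite (morphV hnn_baseM).
exists (V ++ W); rewrite word_val_cons -EV -EW.
by rewrite !hnn_valueE word_val_cat.
Qed.

Lemma hnn_rules_isomorphic : monoid_isomorphic (pres_monoid hnn_rules) G.
Proof.
have value_class W :
    hnn_value (pres_repr (pres_class hnn_rules W)) = hnn_value W.
  exact: (ev_congr hnn_value_step (pres_repr_class _ _)).
apply: (@bijective_monoid_isomorphic (pres_monoid hnn_rules) G
  (fun p => hnn_value (pres_repr p))).
- by rewrite value_class.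
- move=> p q; rewrite -[p]pres_reprK -[q]pres_reprK [_ * _]pres_mulE.
  rewrite !value_class.
  by rewrite !hnn_valueE word_val_cat.
- move=> p q E; rewrite -[p]pres_reprK -[q]pres_reprK; apply/pres_classP.
  exact: (ev_pres_congr hnn_lt_wf hnn_step_lt hnn_value_step hnn_value_inj E).
- move=> g; have [W <-] := hnn_value_surj g.
  by exists (pres_class _ W); rewrite value_class.
Qed.

Lemma hnn_rules_complete : complete_system hnn_rules.
Proof.
exact: (unique_normal_form_complete hnn_lt_wf hnn_step_lt hnn_value_step
  hnn_value_inj).
Qed.

End HNNRewriting.

Theorem corollary1p3 (A C : groupType)
    (freeA : is_free_group A) (fgA : finitely_generated A)
    (freeC : is_free_group C) (fgC : finitely_generated C)
    (i1 i2 : {multiplicative C -> A})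
    (inj1 : injective i1) (inj2 : injective i2) :
  admits_finite_complete_rewriting_system (hnn_extension i1 i2).
Proof.
(* The sign [e] selects the embedding whose image can be carried across t^e from left to right. *)
pose i e : C -> A := if e then i1 else i2.
have iM e : {morph i e : x y / x * y} by case: e; exact: gmulfM.
have i_inj e : injective (i e) by case: e.
have [I [b basis_b]] := free_fg_finite_basis freeA fgA.
have [rep repP] := choice (fun ea : bool * A =>
  coset_minimal_exists (iM ea.1) basis_b ea.2).
have [word wordK] := choice basis_b.1.
pose nf a := reduce (word a).
have nf_val a : word_val b (nf a) = a by rewrite word_val_reduce.
have nf_red a : reduced (nf a) by exact: reduced_reduce.
pose rep' e a := rep (e, a).
have rep_val e a := (repP (e, a)).1.
have rep_min e a := (repP (e, a)).2.
exists (option I * bool)%type, (hnn_rules i b rep' nf); split.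
- exact: hnn_rules_finite.
- exact: (hnn_rules_complete iM i_inj basis_b rep_val rep_min nf_val nf_red).
- exact: (hnn_rules_isomorphic iM i_inj basis_b rep_val rep_min nf_val nf_red).
Qed.
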